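(* Let $v\in\{a,b\}^*$ be non-constant and $\{x,y\}=\{a,b\}$. Then $D\,\psi(v)xy=\psi({}_+v)xy$.
   Context: Palindromization map: $\psi(\varepsilon)=\varepsilon$, $\psi(uz)=(\psi(u)z)^{(+)}$ for a word $u$ and letter $z$, where $t^{(+)}$ is the shortest palindrome with prefix $t$. Proper standard words are the words $\psi(u)xy$ with $u\in\{a,b\}^*$ and $\{x,y\}=\{a,b\}$; their index is that of $u$: $0$ if $u=\varepsilon$, else the length $\alpha_0$ of the first run of $u$ (writing $u=x_0^{\alpha_0}\cdots x_n^{\alpha_n}$, $\alpha_i\ge1$, $x_{i+1}\ne x_i$). For $k\ge0$ let $\mu_k$ be the morphism $a\mapsto a^kba$, $b\mapsto a^kb$ and $\hat\mu_k$ the morphism $a\mapsto b^ka$, $b\mapsto b^kab$; the codes $\{a^kb,a^kba\}$ and $\{b^ka,b^kab\}$ give unique factorizations. Derivative of a proper standard word $w$ of index $k$: if $w$ begins with $a$, then $w\in\{a^kb,a^kba\}^*\cup\{a^{k+1}b\}$, and $Dw=\mu_k^{-1}(w)$ if $w\in\{a^kb,a^kba\}^*$, while $D(a^{k+1}b)=b$; if $w$ begins with $b$, then $w\in\{b^ka,b^kab\}^*\cup\{b^{k+1}a\}$, and $Dw=\hat\mu_k^{-1}(w)$ if $w\in\{b^ka,b^kab\}^*$, while $D(b^{k+1}a)=a$. A word is constant if it is a power of a single letter. For non-constant $v$, ${}_+v$ is the longest suffix of $v$ immediately preceded by the letter different from the first letter of $v$. *)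

(* Defs.v *)
From mathcomp Require Import all_boot.
From mathcomp Require Import boolp classical_sets.

Set Implicit Arguments.
Unset Strict Implicit.
Unset Printing Implicit Defensive.

(* The two-letter alphabet {a, b} is [bool]; the letter other than [z] is
   [~~ z].  A power of a single letter is a word [w] with [constant w]. *)
Definition word := seq bool.

Definition palindrome (p : word) : bool := rev p == p.

(* Here and below, [xget [::] P] (or [xget 0 P]) denotes the element satisfying
   [P]; the value [[::]] (or [0]) is only used when there is none. *)
Definition pal_closure (t : word) : word :=
  xget [::] [set p : word | [/\ palindrome p, prefix t p &
    forall q : word, palindrome q -> prefix t q -> size p <= size q]]%classic.

Definition psi (u : word) : word :=
  foldl (fun p z => pal_closure (rcons p z)) [::] u.

(* alpha_0 in u = x_0^alpha_0 x_1^alpha_1 ..., and 0 if u is empty. *)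
Definition first_run (u : word) : nat :=
  if u is x :: _ then find (predC1 x) u else 0.

Definition standard_word_of (u w : word) : Prop :=
  exists x y : bool, x != y /\ w = psi u ++ [:: x; y].

(* Only meaningful if [w] is a proper standard word. *)
Definition index_of (w : word) : nat :=
  xget 0 [set k : nat |
    exists u : word, standard_word_of u w /\ k = first_run u]%classic.

(* The morphism z |-> z^k z' z, z' |-> z^k z', where z' is the letter other than
   z: this is mu_k for z = a and \hat mu_k for z = b. *)
Definition mu (z : bool) (k : nat) (w : word) : word :=
  flatten [seq nseq k z ++ (if c == z then [:: ~~ z; z] else [:: ~~ z])
          | c <- w].

(* D, meaningful on proper standard words only.  A word is in
   {z^k z', z^k z' z}^* iff it is in the range of [mu z k]. *)
Definition derivative (w : word) : word :=
  if w is z :: _ then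
    let k := index_of w in
    if `[< exists d : word, mu z k d = w >] then
      xget [::] [set d : word | mu z k d = w]%classic
    else if w == rcons (nseq k.+1 z) (~~ z) then [:: ~~ z]
    else [::]
  else [::].

(* [s] is a suffix of [v] immediately preceded by the letter different from the
   first letter of [v]. *)
Definition preceded_suffix (v s : word) : Prop :=
  exists (x : bool) (p : word), ohead v = Some x /\ v = p ++ ~~ x :: s.

(* {}_+v, meaningful for non-constant v. *)
Definition plus_suffix (v : word) : word :=
  xget [::] [set s : word | preceded_suffix v s /\
    forall s' : word, preceded_suffix v s' -> size s' <= size s]%classic.

(* Main.v *)
Require Import Defs.
From mathcomp Require Import all_boot.
From mathcomp Require Import boolp classical_sets.

Set Implicit Arguments.
Unset Strict Implicit.
Unset Printing Implicit Defensive.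

(** Writing [L_z] for the morphism [z |-> z, z' |-> z z'], Justin's formula
    [psi (z u) = L_z (psi u) z] holds because every occurrence of [z] in
    [L_z (t) z] starts a block, so that the palindromic suffixes of [L_z (t) z]
    starting with [z] are exactly the [L_z (g) z] with [g] a palindromic suffix
    of [t].  Since [mu_k] is [L_z^k] composed with [L_z'], iterating the formula
    on [v = z^k z' s] gives [psi v = mu_k (psi s) z^k z' z^k], and
    [z^k z' z^k x y = mu_k (x y)]. *)

(** * Longest palindromic suffixes and the palindromic closure *)

Definition longest_pal_suffix (f g : word) : Prop :=
  palindrome g /\ forall f' g' : word, f' ++ g' = f ++ g -> palindrome g' ->
  size f <= size f'.

Lemma longest_pal_suffix_exists (t : word) :
  exists f g, t = f ++ g /\ longest_pal_suffix f g.
Proof.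
have ex : exists n, palindrome (drop n t).
  by exists (size t); rewrite drop_size.
case: (ex_minnP ex) => n pal_n min_n.
exists (take n t), (drop n t); rewrite cat_take_drop; split=> //; split=> //.
move=> f' g' E pal_g'.
have /min_n le_n : palindrome (drop (size f') t).
  by rewrite -(cat_take_drop n t) -E drop_size_cat.
by apply: leq_trans le_n; rewrite size_take_min geq_minl.
Qed.

Lemma palindrome_cat (t r : word) : size r <= size t -> palindrome (t ++ r) ->
  exists2 d, palindrome d & t = rev r ++ d.
Proof.
move=> le_rt /eqP; rewrite rev_cat => E.
have rE : rev r = take (size r) t.
  have := congr1 (take (size r)) E.
  by rewrite take_size_cat ?size_rev // takel_cat.
exists (drop (size r) t); last by rewrite rE cat_take_drop.
move: E; rewrite -{1 2}(cat_take_drop (size r) t) -rE rev_cat revK -catA.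
by move/eqP; rewrite eqseq_cat // eqxx eqseq_cat ?size_rev // eqxx andbT.
Qed.

(** A palindrome [f ++ g ++ r] with [r] no longer than [f] leaves, once [rev r] and [r] are peeled
    off its ends, a palindromic suffix of [f ++ g]. Minimality of [f] then forces [r = rev f], which
    gives both existence and uniqueness for [xget]. *)
Lemma pal_closureE (f g : word) : longest_pal_suffix f g ->
  pal_closure (f ++ g) = f ++ g ++ rev f.
Proof.
move=> [/eqP pal_g min_f].
have pal_p : palindrome (f ++ g ++ rev f).
  by rewrite /palindrome !rev_cat revK pal_g catA.
have pre_p : prefix (f ++ g) (f ++ g ++ rev f) by rewrite catA prefix_prefix.
have main q : palindrome q -> prefix (f ++ g) q ->
    size q <= size (f ++ g ++ rev f) -> q = f ++ g ++ rev f.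
  move=> pal_q /prefixP[r qE]; rewrite qE in pal_q *.
  rewrite catA !(size_cat (f ++ g)) leq_add2l size_rev => le_rf.
  have [|d pal_d E] := palindrome_cat _ pal_q.
    by rewrite size_cat (leq_trans le_rf) ?leq_addr.
  have := min_f _ _ (esym E) pal_d; rewrite size_rev => le_fr.
  have /eqP : f ++ g = rev r ++ d by [].
  rewrite eqseq_cat ?size_rev; last by apply/eqP; rewrite eqn_leq le_fr le_rf.
  by case/andP=> /eqP -> _; rewrite revK.
rewrite /pal_closure; apply: xget_unique => /=.
  split=> // q pal_q pre_q.
  by have [/main->|/ltnW] := leqP (size q) (size (f ++ g ++ rev f)).
by move=> q [pal_q pre_q /(_ _ pal_p pre_p)]; apply: main.
Qed.

(** Stripping both end letters from a palindromic suffix of [f z g z] leaves a palindromic suffix of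
    [f z g]. *)
Lemma longest_pal_suffix_rcons (z : bool) (f g : word) :
  longest_pal_suffix (rcons f z) g -> longest_pal_suffix f (z :: rcons g z).
Proof.
move=> [/eqP pal_g min_f]; split=> [|f' g' E pal_g'].
  by rewrite /palindrome rev_cons rev_rcons pal_g.
have sz : size f' + size g' = (size f + (size g).+2).
  by rewrite -size_cat E size_cat /= size_rcons.
have [le2|lt2] := leqP 2 (size g'); last first.
  by rewrite -(leq_add2r (size g')) sz leq_add2l; apply: leq_trans (ltnW lt2) _.
case: g' => [//|c g'] in E pal_g' le2 sz *.
case/lastP: g' => [//|g' c'] in E pal_g' le2 sz *.
move: pal_g'; rewrite /palindrome rev_cons rev_rcons rcons_cons eqseq_cons.
rewrite eqseq_rcons => /and3P[/eqP c'E pal_g' _].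
move: E; rewrite -!rcons_cons -!rcons_cat => /rcons_inj[E zE].
have := min_f (rcons f' c) g'; rewrite !cat_rcons E !size_rcons.
by move/(_ erefl pal_g').
Qed.

(** * The morphism [L_z] and Justin's formula *)

Definition justin (z : bool) (w : word) : word :=
  flatten [seq if c == z then [:: z] else [:: z; ~~ z] | c <- w].

Lemma justin_cat z w1 w2 : justin z (w1 ++ w2) = justin z w1 ++ justin z w2.
Proof. by rewrite /justin map_cat flatten_cat. Qed.

Lemma justin_cons z c w : justin z (c :: w) =
  (if c == z then [:: z] else [:: z; ~~ z]) ++ justin z w.
Proof. by []. Qed.

(** Reversal turns the block [z z'] into [z' z]; the extra final [z] restores the block
    boundaries. *)
Lemma justin_rev z w : rev (rcons (justin z w) z) = rcons (justin z (rev w)) z.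
Proof.
rewrite rev_rcons; elim: w => [//|c w IH].
rewrite justin_cons rev_cat -cat_cons IH rev_cons -(cats1 (rev w)) justin_cat.
by rewrite justin_cons cats0 cat_rcons rcons_cat; case: eqP.
Qed.

Lemma justin_inj z : injective (justin z).
Proof.
elim=> [|c w IH] [|c' w'] //; rewrite !justin_cons.
- by case: eqP.
- by case: eqP.
(* Every block starts with [z], so a [~~ z] after the leading [z] tells the two blocks apart. *)
have head d u : justin z u <> ~~ z :: d.
  by case: u => [//|e u]; rewrite justin_cons; case: eqP => _ [] /eqP; case: (z).
case: eqP => cz; case: eqP => c'z //=.
- by move=> [/IH->]; rewrite cz c'z.
- by move=> [/head].
- by move=> [/esym /head].
by move=> [/IH->]; congr (_ :: _); case: c c' z cz c'z {IH head} => [] [] [].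
Qed.

Lemma palindrome_justin z w : palindrome (rcons (justin z w) z) = palindrome w.
Proof.
rewrite /palindrome justin_rev eqseq_rcons eqxx andbT.
by apply: inj_eq; apply: justin_inj.
Qed.

Lemma justin_suffix z w F G : rcons (justin z w) z = F ++ z :: G ->
  exists f g, [/\ w = f ++ g, F = justin z f & z :: G = rcons (justin z g) z].
Proof.
elim: w F => [|c w IH] F.
  case: F => [[<-]|d [|e F] []//].
  by exists [::], [::].
rewrite justin_cons; case: F => [E|d F].
  by exists [::], (c :: w); rewrite justin_cons.
case: (eqVneq c z) => [->|cz] /= [<-].
  move=> /IH[f [g [-> -> ->]]]; exists (z :: f), g; split=> //.
  by rewrite justin_cons eqxx.
case: F => [[]|e F [<-]]; first by move/eqP; case: (z).
move=> /IH[f [g [-> -> ->]]]; exists (c :: f), g; split=> //.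
by rewrite justin_cons (negPf cz).
Qed.

Lemma justin_before z w F G : rcons (justin z w) z = F ++ ~~ z :: G ->
  exists F', F = rcons F' z.
Proof.
elim: w F => [|c w IH] F.
  by case: F => [|d [|e F]] [] // /eqP; case: (z).
rewrite justin_cons; case: F => [|d F].
  by case: eqP => _ [] /eqP; case: (z).
case: eqP => _ /= [<-].
  by move=> /IH[F' ->]; exists (z :: F').
case: F => [_|e F [<-]]; first by exists [::].
by move=> /IH[F' ->]; exists (z :: ~~ z :: F').
Qed.

Lemma pal_closure_justin z t :
  pal_closure (rcons (justin z t) z) = rcons (justin z (pal_closure t)) z.
Proof.
have [f [g [-> lps]]] := longest_pal_suffix_exists t.
have lpsL : longest_pal_suffix (justin z f) (rcons (justin z g) z).
  case: lps => pal_g min_f; split=> [|F G E pal_G].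
    by rewrite palindrome_justin.
  (* The empty suffix has no leading [z] and is treated apart: there [F] is the whole word. *)
  case/lastP: G => [|G d] in E pal_G *.
    move: (congr1 size E); rewrite cats0 size_cat => ->.
    exact: leq_addr.
  have dz : d = z.
    by move: E; rewrite -!rcons_cat => /rcons_inj[].
  rewrite dz in E pal_G.
  have [G' GE] : exists G', rcons G z = z :: G'.
    by move/eqP: pal_G; rewrite rev_rcons => <-; exists (rev G).
  move: E; rewrite GE -rcons_cat -justin_cat => /esym /justin_suffix.
  case=> f' [g' [E -> gE]].
  have pal_g' : palindrome g' by rewrite -(palindrome_justin z) -gE -GE.
  have le_f := min_f _ _ (esym E) pal_g'.
  (* Both [f] and [f'] are prefixes of the same word, so the comparison of lengths passes to their
     images. *)
  have -> : f' = f ++ drop (size f) f'.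
    have := congr1 (take (size f)) E.
    rewrite take_size_cat // takel_cat // => ->.
    by rewrite size_takel // cat_take_drop.
  by rewrite justin_cat size_cat leq_addr.
rewrite justin_cat rcons_cat (pal_closureE lpsL) (pal_closureE lps).
rewrite !justin_cat !rcons_cat; congr (_ ++ _).
by rewrite -justin_rev rev_rcons cat_rcons.
Qed.

(* Since [z' z'] does not occur in [L_z (q) z z'], the longest palindromic suffix
   of this word is preceded by [z], so its closure continues with [z]. *)
Lemma pal_closure_justin_rcons z q c :
  pal_closure (rcons (rcons (justin z q) z) c) =
  pal_closure (rcons (justin z (rcons q c)) z).
Proof.
rewrite -(cats1 q) justin_cat justin_cons cats0.
case: (eqVneq c z) => [->|cz]; first by rewrite cats1.
have -> : c = ~~ z by case: c z cz => [] [].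
set T := rcons (rcons _ _) _.
have TE : rcons (justin z q ++ [:: z; ~~ z]) z = rcons T z.
  by rewrite /T -!cats1 -!catA.
rewrite TE.
have [f [g [E lps]]] := longest_pal_suffix_exists T.
have [g' gE] : exists g', g = ~~ z :: g'.
  case: lps => /eqP pal_g min_f.
  (* The single letter [~~ z] is a palindromic suffix of [T], so the longest one is nonempty. *)
  case/lastP: g => [|g d] in pal_g E min_f *.
    have := min_f (rcons (justin z q) z) [:: ~~ z].
    rewrite cats1 -/T E => /(_ erefl (eqxx _)).
    by rewrite -(cats0 f) -E /T !size_rcons ltnn.
  have dz : ~~ z = d by move: E; rewrite /T -rcons_cat => /rcons_inj[].
  by move: pal_g; rewrite -dz rev_rcons => <-; exists (rev g).
have [f' fE] : exists f', f = rcons f' z.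
  apply: (@justin_before z (rcons q (~~ z)) f (rcons g' z)).
  rewrite -(cats1 q) justin_cat justin_cons cats0.
  have -> : (~~ z == z) = false by case: (z).
  by rewrite TE E gE -rcons_cons -rcons_cat.
rewrite E fE; rewrite fE in lps.
rewrite (pal_closureE lps) rcons_cat !cat_rcons.
rewrite (pal_closureE (longest_pal_suffix_rcons lps)).
by rewrite rev_rcons cat_cons cat_rcons.
Qed.

Lemma psi_rcons u c : psi (rcons u c) = pal_closure (rcons (psi u) c).
Proof. by rewrite /psi foldl_rcons. Qed.

Lemma pal_closure_nil : pal_closure [::] = [::].
Proof. by rewrite (@pal_closureE [::] [::]). Qed.

(** Induction at the end of [u], where [psi] recurses: the two preceding closure lemmas carry [L_z]
    across one more closure. *)
Lemma psi_cons z u : psi (z :: u) = rcons (justin z (psi u)) z.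
Proof.
elim/last_ind: u => [|u c IH].
  have := pal_closure_justin z [::].
  by rewrite pal_closure_nil.
by rewrite -rcons_cons !psi_rcons IH pal_closure_justin_rcons pal_closure_justin.
Qed.

(** * Iterating Justin's formula along a run: the morphisms [mu z k] *)

Lemma justin_nseq z k : justin z (nseq k z) = nseq k z.
Proof. by elim: k => //= k IH; rewrite justin_cons eqxx IH. Qed.

Lemma nseq_rcons (z : bool) k : rcons (nseq k z) z = nseq k.+1 z.
Proof. by elim: k => //= k ->. Qed.

Lemma cons_nseq_cat (z : bool) k s : z :: nseq k z ++ s = nseq k z ++ z :: s.
Proof. by rewrite -cat_rcons nseq_rcons. Qed.

Lemma psi_nseq z k : psi (nseq k z) = nseq k z.
Proof. by elim: k => //= k IH; rewrite psi_cons IH justin_nseq nseq_rcons. Qed.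

Lemma mu_cat z k w1 w2 : mu z k (w1 ++ w2) = mu z k w1 ++ mu z k w2.
Proof. by rewrite /mu map_cat flatten_cat. Qed.

Lemma mu_cons z k c w : mu z k (c :: w) =
  (nseq k z ++ if c == z then [:: ~~ z; z] else [:: ~~ z]) ++ mu z k w.
Proof. by []. Qed.

Lemma mu0 z w : mu z 0 w = justin (~~ z) w.
Proof.
rewrite /mu /justin; congr flatten; apply: eq_map => c.
by rewrite negbK /=; case: c z => [] [].
Qed.

Lemma mu_justin z k w : justin z (mu z k w) = mu z k.+1 w.
Proof.
elim: w => [//|c w IH].
rewrite !mu_cons justin_cat IH; congr (_ ++ _).
rewrite justin_cat justin_nseq -addn1 nseqD -catA; congr (_ ++ _).
by case: (c == z); rewrite !justin_cons ?eqxx; case: (z).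
Qed.

(** The tail starts as the [z'] appended for the letter [~~ z]; each further [L_z] adds a [z] in
    front of [z'], and Justin's formula appends one at the end. *)
Lemma psi_run z k s :
  psi (nseq k z ++ ~~ z :: s) = mu z k (psi s) ++ nseq k z ++ ~~ z :: nseq k z.
Proof.
elim: k => [|k IH] /=; first by rewrite psi_cons mu0 cats1.
rewrite psi_cons IH !justin_cat mu_justin rcons_cat; congr (_ ++ _).
rewrite justin_cons justin_nseq cons_nseq_cat !rcons_cat nseq_rcons.
by case: (z).
Qed.

(** If [x = z], this letter slides across [z^k] to complete the first block; otherwise the blocks
    are already in place. *)
Lemma mu_pair z k x y : x != y ->
  nseq k z ++ ~~ z :: nseq k z ++ [:: x; y] = mu z k [:: x; y].
Proof.
move=> xy; rewrite /mu /= cats0 -!catA; congr (_ ++ _).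
have -> : y = ~~ x by case: x y xy => [] [].
have -> : (~~ x == z) = ~~ (x == z) by case: (x) (z) => [] [].
case: (eqVneq x z) => [->|xz] /=; last first.
  by have -> : x = ~~ z; [case: (x) (z) xz => [] [] | rewrite negbK].
by rewrite cons_nseq_cat.
Qed.

Lemma mu_psi z k s x y : x != y ->
  mu z k (psi s ++ [:: x; y]) = psi (nseq k z ++ ~~ z :: s) ++ [:: x; y].
Proof. by move=> xy; rewrite mu_cat psi_run -mu_pair // -!catA. Qed.

(* The last letter of a word in the range of [mu z k] determines its last block. *)
Lemma mu_inj z k : injective (mu z k).
Proof.
have step c w : mu z k (rcons w c) = mu z k w ++ mu z k [:: c].
  by rewrite -cats1 mu_cat.
have last1 c : mu z k [:: c] =
    rcons (nseq k z ++ if c == z then [:: ~~ z] else [::]) c.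
  rewrite /mu /= cats0 -cats1 -catA; case: (eqVneq c z) => [->//|cz].
  by have -> : c = ~~ z by case: (c) (z) cz => [] [].
elim/last_ind => [|w c IH]; elim/last_ind => [|w' c' _] //; rewrite !step !last1.
- by rewrite -rcons_cat => /(congr1 size); rewrite size_rcons.
- by rewrite -rcons_cat => /(congr1 size); rewrite size_rcons.
rewrite -!rcons_cat => /rcons_inj[E cc]; rewrite cc in E *.
have sz : size (mu z k w) = size (mu z k w').
  by move/(congr1 size): E; rewrite !size_cat => /addIn.
by move/eqP: E; rewrite eqseq_cat // => /andP[/eqP/IH->].
Qed.

(** * First runs, the index and the suffix [plus_suffix v] *)

Variant run_spec : word -> Prop :=
| RunNil : run_spec [::]
| RunConstant z k : run_spec (nseq k.+1 z)
| RunBreak z k s : run_spec (nseq k.+1 z ++ ~~ z :: s).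

Lemma runP u : run_spec u.
Proof.
case: u => [|z u]; first by constructor.
suff [[k ->]|[k [s ->]]] : (exists k, u = nseq k z) \/
    exists k s, u = nseq k z ++ ~~ z :: s.
- exact: (RunConstant z k).
- exact: (RunBreak z k s).
elim: u => [|c u IH]; first by left; exists 0.
case: (eqVneq c z) => [->|cz].
  case: IH => [[k ->]|[k [s ->]]]; first by left; exists k.+1.
  by right; exists k.+1, s.
by right; exists 0, u; case: c z cz {IH} => [] [].
Qed.

Lemma first_run_break z k s : first_run (nseq k.+1 z ++ ~~ z :: s) = k.+1.
Proof.
rewrite /first_run /= eqxx /=; congr _.+1.
by elim: k => [|k IH] /=; [case: (z) | rewrite eqxx /= IH].
Qed.

(** This lets the index be read off a standard word, whichever [u] produces it. *)
Lemma first_run_psi u : first_run (psi u) = first_run u.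
Proof.
case: u / runP => [//|z k|z k s]; first by rewrite psi_nseq.
have [r ->] : exists r, psi (nseq k.+1 z ++ ~~ z :: s) = nseq k.+1 z ++ ~~ z :: r.
  (* Both blocks of [mu z k.+1] begin with [z^(k+1) z'], and so does the tail when [psi s] is
     empty. *)
  rewrite psi_run; case: (psi s) => [|c q]; first by exists (nseq k.+1 z).
  rewrite mu_cons -!catA.
  by case: (c == z); eexists.
by rewrite !first_run_break.
Qed.

Lemma index_ofE u x y : x != y -> index_of (psi u ++ [:: x; y]) = first_run u.
Proof.
move=> xy; apply: xget_unique => [|k] /=; first by exists u; split=> //; exists x, y.
case=> u' [[x' [y' [_ /eqP E]]] ->].
have sz : size (psi u) = size (psi u').
  by move/eqP: E => /(congr1 size); rewrite !size_cat => /addIn.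
move: E; rewrite eqseq_cat // => /andP[/eqP E _].
by rewrite -first_run_psi -E first_run_psi.
Qed.

(** The leading run contains no [~~ z], so the earliest admissible predecessor is the letter just
    before [s]. *)
Lemma plus_suffixE z k s : plus_suffix (nseq k.+1 z ++ ~~ z :: s) = s.
Proof.
have longest s' : preceded_suffix (nseq k.+1 z ++ ~~ z :: s) s' ->
    exists p, s = p ++ s'.
  case=> x [p [[<-] E]].
  elim: {k}k.+1 p E => [|k IH] [|c p] /= [].
  - by move=> ->; exists [::].
  - by move=> _ ->; exists (rcons p (~~ z)); rewrite cat_rcons.
  - by move=> /eqP; case: (z).
  - by move=> _ /IH.
have pre_s : preceded_suffix (nseq k.+1 z ++ ~~ z :: s) s.
  by exists z, (nseq k.+1 z).
apply: xget_unique => [|s' [/longest[p sE] /(_ _ pre_s)]] /=.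
  by split=> // s' /longest[p ->]; rewrite size_cat leq_addl.
by rewrite sE size_cat -{2}(add0n (size s')) leq_add2r; case: p {sE}.
Qed.

Theorem mainTheorem17 (v : word) (x y : bool) :
  ~~ constant v -> x != y ->
  derivative (psi v ++ [:: x; y]) = psi (plus_suffix v) ++ [:: x; y].
Proof.
case: v / runP => [//|z k|z k s].
  by rewrite /= (@all_nseq _ (pred1 z) k z) /= eqxx orbT.
move=> _ xy; rewrite plus_suffixE.
have idx := index_ofE (nseq k.+1 z ++ ~~ z :: s) xy.
rewrite first_run_break in idx.
have muE := mu_psi z k.+1 s xy.
(* [derivative] branches on the first letter, which is [z] because the exponent [k.+1] is
   positive. *)
have [w wE] : exists w, psi (nseq k.+1 z ++ ~~ z :: s) ++ [:: x; y] = z :: w.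
  by rewrite -muE; case: (psi s) => [|c q]; rewrite /mu /=; eexists.
rewrite wE in idx muE *; rewrite /derivative idx.
(* The preimage given by [mu_psi] selects the first branch, and [mu_inj] makes it the only one. *)
case: asboolP => [_|[]]; last by eexists; exact: muE.
by apply: xget_unique => //= d; rewrite -muE => /mu_inj.
Qed.
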